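(* Fix an integer $k\ge1$. Let $\phi(s)=c_0s+\varphi(s)$ with $c_0\in\mathbb{N}_0$ and $\varphi\in\mathcal{D}_k$, be a non-constant analytic map $\mathbb{C}_0\to\mathbb{C}_0$ such that $C_\phi f=f\circ\phi$ maps $\mathcal{A}_k^+$ into itself. Then $C_\phi:\mathcal{A}_k^+\to\mathcal{A}_k^+$ is an isometry if and only if $\phi(s)=c_0s+i\tau$ with $c_0\in\mathbb{N}=\{1,2,\dots\}$ and $\tau\in\mathbb{R}$.
   Context: $\mathbb{C}_0=\{\operatorname{Re}s>0\}$. $\mathcal{A}^+$ is the Banach algebra of Dirichlet series $f(s)=\sum_{n\ge1}a_nn^{-s}$ with $\|f\|_{\mathcal{A}^+}=\sum|a_n|<\infty$ (pointwise product). $\mathcal{D}$ is the space of analytic functions on $\mathbb{C}_0$ representable by a convergent Dirichlet series for $\operatorname{Re}s$ large. Let $p_1<\dots<p_k$ be the first $k$ primes and $P^+(n)$ the largest prime factor of $n$ ($P^+(1)=1$). $\mathcal{A}_k^+$ is the subalgebra of $f\in\mathcal{A}^+$ with $a_n=0$ unless $P^+(n)\le p_k$ (the Dirichlet expansion only involves $p_1,\dots,p_k$), with the norm of $\mathcal{A}^+$; $\mathcal{D}_k$ is defined similarly as the subspace of $\mathcal{D}$ whose Dirichlet expansions only involve integers $n$ with all prime factors among $p_1,\dots,p_k$. *)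

(* Defs.v *)
From Stdlib Require Import Reals.
From Coquelicot Require Import Coquelicot.
From mathcomp Require Import ssreflect ssrbool ssrnat seq prime.

Open Scope R_scope.

(* pi(p) = number of primes <= p.  A prime p is one of the first k primes
   p_1 < ... < p_k  iff  pi(p) <= k. *)
Definition prime_pi (p : nat) : nat := count prime (iota 0 p.+1).

Definition smooth (k n : nat) : bool :=
  (0 < n)%N && all (fun p => (prime_pi p <= k)%N) (primes n).

(* n^{-s} for n >= 1 and s in C:  exp(-s log n) *)
Definition npow (n : nat) (s : C) : C :=
  let L := ln (INR n) in
  let r := exp (- Re s * L) in
  (r * cos (- Im s * L), r * sin (- Im s * L)).

(* coefficient sequences a : nat -> C (a 0 unused, forced to be 0) *)
Definition dterm (a : nat -> C) (s : C) (n : nat) : C := Cmult (a n) (npow n s).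

Definition dseries_to (a : nat -> C) (s : C) (v : C) : Prop :=
  is_series (dterm a s) v.

Definition supported_k (k : nat) (a : nat -> C) : Prop :=
  forall n, smooth k n = false -> a n = 0.

Definition in_Akplus (k : nat) (a : nat -> C) : Prop :=
  supported_k k a /\ ex_series (fun n => Cmod (a n)).

Definition normA (a : nat -> C) : R := Series (fun n => Cmod (a n)).

Definition holomorphic_C0 (f : C -> C) : Prop :=
  forall s : C, 0 < Re s -> @ex_derive C_AbsRing (AbsRing_NormedModule C_AbsRing) f s.

Definition in_Dk (k : nat) (f : C -> C) : Prop :=
  holomorphic_C0 f /\
  exists b : nat -> C, supported_k k b /\
    exists sigma : R, forall s : C, sigma < Re s -> dseries_to b s (f s).

Definition comp_rel (phi : C -> C) (a b : nat -> C) : Prop :=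
  forall s : C, 0 < Re s ->
    forall v : C, dseries_to a (phi s) v -> dseries_to b s v.

(* Main.v *)
Require Import Defs.
From Stdlib Require Import Reals Lra Lia.
From Coquelicot Require Import Coquelicot.
From mathcomp Require Import ssreflect ssrbool ssrfun eqtype ssrnat seq prime.
From mathcomp Require Import zify.
Open Scope R_scope.

(* If C_phi is an isometry, then for smooth m <> m' the norms of
   m^{-phi} + m'^{-phi} and m^{-phi} - m'^{-phi} are both 2; by the parallelogram
   law the Dirichlet coefficients of m^{-phi} and m'^{-phi} have disjoint
   supports.  Write psi = c_1 + u, where u = c_N N^{-s} + ... has leading term at
   N >= 2.  The leading term of m^{-phi} = m^{-c0 s} m^{-psi} is m^{-c_1} (m^c0)^{-s},
   so m^c0 lies in the support of m^{-phi} and in no other one; taking m = 1, 2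
   excludes c0 = 0.  Put e = 2^{-u} and Q = 2^c0.  By disjointness from
   (2^i N)^{-phi}, every series Q^{-is} e^i, a multiple of (2^i)^{-phi}, has zero
   coefficient at Q^i N^c0.  Hence so has Q^{-c0 s} (1 - e)^c0 at Q^c0 N^c0, being a
   combination of shifts of these series, whereas its leading coefficient there
   is (c_N log 2)^c0.  Therefore u = 0 far to the right, 2^{-psi} = 2^{-c_1} on C_0
   by uniqueness of coefficients, psi = c_1 by continuity, and Re c_1 = 0 because
   2^{-phi} has norm 1.  All limits are taken along natural numbers s. *)

(** * The monomials n^{-s} *)

Definition cexp (z : C) : C := (exp (Re z) * cos (Im z), exp (Re z) * sin (Im z)).

Lemma C_eq (z w : C) : Re z = Re w -> Im z = Im w -> z = w.
Proof. by case: z => a b; case: w => c d /= -> ->. Qed.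

Lemma cexpD (z w : C) : cexp (Cplus z w) = Cmult (cexp z) (cexp w).
Proof.
case: z => a b; case: w => c d; apply: C_eq; rewrite /= exp_plus.
- rewrite cos_plus; ring.
- rewrite sin_plus; ring.
Qed.

Lemma cexp0 : cexp 0 = 1.
Proof. by rewrite /cexp /= exp_0 cos_0 sin_0 Rmult_1_l Rmult_0_r. Qed.

Lemma Cmod_cexp (z : C) : Cmod (cexp z) = exp (Re z).
Proof.
rewrite /Cmod /cexp /=.
have -> : exp (Re z) * cos (Im z) * (exp (Re z) * cos (Im z) * 1) +
   exp (Re z) * sin (Im z) * (exp (Re z) * sin (Im z) * 1) = (exp (Re z)) ^ 2.
  by have := sin2_cos2 (Im z); rewrite /Rsqr => h; nra.
by apply: sqrt_pow2; apply/Rlt_le/exp_pos.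
Qed.

Lemma cexp_neq0 (z : C) : cexp z <> 0.
Proof. by apply/Cmod_gt_0; rewrite Cmod_cexp; apply: exp_pos. Qed.

Lemma npowE (n : nat) (s : C) : npow n s = cexp (Copp (Cmult s (RtoC (ln (INR n))))).
Proof. by case: s => a b; apply: C_eq; rewrite /npow /=; do 2!f_equal; ring. Qed.

Lemma npow_neq0 (n : nat) (s : C) : npow n s <> 0.
Proof. by rewrite npowE; apply: cexp_neq0. Qed.

Lemma Cmod_npow (n : nat) (s : C) : Cmod (npow n s) = exp (- Re s * ln (INR n)).
Proof. by rewrite npowE Cmod_cexp; case: s => a b /=; f_equal; ring. Qed.

Lemma npow1 (s : C) : npow 1 s = 1.
Proof. by rewrite npowE /= ln_1 Cmult_0_r; rewrite -cexp0; congr cexp; ring. Qed.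

Lemma npowD (n : nat) (s t : C) : npow n (Cplus s t) = Cmult (npow n s) (npow n t).
Proof. by rewrite !npowE -cexpD; congr cexp; ring. Qed.

Lemma INR_gt0 (n : nat) : (0 < n)%N -> 0 < INR n.
Proof. by move=> h; apply: lt_0_INR; lia. Qed.

Lemma npow_mul (m n : nat) (s : C) : (0 < m)%N -> (0 < n)%N ->
  npow (m * n) s = Cmult (npow m s) (npow n s).
Proof.
move=> hm hn; rewrite !npowE -cexpD mult_INR ln_mult; try exact: INR_gt0.
by congr cexp; rewrite RtoC_plus; ring.
Qed.

Lemma INR_expn (n c : nat) : INR (n ^ c)%N = INR n ^ c.
Proof. by elim: c => [|c IH]; rewrite ?expn0 // expnS mult_INR IH. Qed.

Lemma npow_expn (n c : nat) (s : C) : (0 < n)%N ->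
  npow (n ^ c) s = npow n (Cmult (RtoC (INR c)) s).
Proof.
move=> hn; rewrite !npowE INR_expn ln_pow; last exact: INR_gt0.
by congr cexp; rewrite RtoC_mult; ring.
Qed.

(** At natural arguments the monomials are real geometric sequences in [j], which keeps the limits
    below elementary. Index 0 is different: [ln 0 = 0] makes [npow 0] equal to 1, whereas
    [/ 0 = 0]. *)
Lemma npow_INR (n j : nat) : (0 < n)%N -> npow n (RtoC (INR j)) = RtoC ((/ INR n) ^ j).
Proof.
move=> hn; have h := INR_gt0 _ hn; elim: j => [|j IH].
  by rewrite npowE Cmult_0_l Copp_0 cexp0.
rewrite S_INR RtoC_plus npowD IH.
have -> : npow n 1 = RtoC (/ INR n).
  apply: C_eq; rewrite /npow /=.
  - by rewrite Ropp_0 Rmult_0_l cos_0 -Ropp_mult_distr_l Rmult_1_l exp_Ropp exp_ln // Rmult_1_r.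
  - by rewrite Ropp_0 Rmult_0_l sin_0 Rmult_0_r.
by rewrite -RtoC_mult /= Rmult_comm.
Qed.

(** * Absolutely summable Dirichlet series *)

(** Inserting zero terms only repeats partial sums: the sum of [y] up to [M] is the sum of [x] over
    the [k] with [i k <= M]. No absolute convergence enters. *)
Lemma is_series_reindex {K : AbsRing} {V : NormedModule K} (i : nat -> nat)
    (x y : nat -> V) (v : V) :
  (forall m n, (m < n)%N -> (i m < i n)%N) ->
  (forall n, y (i n) = x n) -> (forall m, (forall n, i n <> m) -> y m = zero) ->
  is_series x v -> is_series y v.
Proof.
move=> hi hy hy0 hx P hP; case: (hx P hP) => N hN.
have hinj : forall m n, i m = i n -> m = n.
  move=> m n e; case: (ltngtP m n) => // /hi; lia.
(* [n] counts the indices [k] with [i k <= M]. As [sum_n] includes its upper bound, a count of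
   [n'.+1] means summing up to [n'], and a count of 0 is the empty sum. *)
have hsum : forall M, exists n, (forall k, (i k <= M)%N = (k < n)%N) /\
    sum_n y M = if n is n'.+1 then sum_n x n' else zero.
  have hstep : forall M n, (forall k, (i k < M)%N = (k < n)%N) ->
    (i n = M /\ y M = x n /\ forall k, (i k <= M)%N = (k < n.+1)%N) \/
    (y M = zero /\ forall k, (i k <= M)%N = (k < n)%N).
    move=> M n hn; case: (eqVneq (i n) M) => [e|ne]; [left|right].
    - split=> //; split; first by rewrite -e.
      move=> k; case: (ltngtP k n) => [h|h|->]; have := hn k; try (have := hi _ _ h); lia.
    - have ne' : forall k, i k <> M.
        move=> k e; case: (ltngtP k n) => [h|h|h].
        + by have := hn k; lia.
        + have := hi _ _ h; have := hn n; lia.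
        + by move/eqP: ne; rewrite -h.
      split; first exact: hy0.
      by move=> k; have := ne' k; have := hn k; lia.
  elim=> [|M [n [hn IH]]].
    case: (hstep 0%N 0%N) => [k|[_ [e hk]]|[e hk]]; first by lia.
    - by exists 1%N; split=> //; rewrite !sum_O.
    - by exists 0%N; split=> //; rewrite !sum_O.
  case: (hstep M.+1 n) => [k|[_ [e hk]]|[e hk]]; first by rewrite -hn; lia.
  - exists n.+1; split=> //; rewrite sum_Sn IH e; case: n {hn hk IH e} => [|n].
      by rewrite plus_zero_l sum_O.
    by rewrite sum_Sn.
  - by exists n; split=> //; rewrite sum_Sn IH e plus_zero_r.
(* Once [M] reaches [i N], more than [N] terms of [x] have been collected. *)
exists (i N) => M hM; case: (hsum M) => n [hn ->].
have := hn N; case: n hn => [|n] hn; first by lia.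
by move=> h; apply: hN; lia.
Qed.

(** These are the coefficients of the sum of [b_n (i n)^{-s}]. A strictly increasing [i] satisfies
    [n <= i n], so a search up to [m] finds the preimage of [m] if there is one. *)
Definition push (i : nat -> nat) (b : nat -> C) (m : nat) : C :=
  if has (fun n => i n == m) (iota 0 m.+1)
  then b (find (fun n => i n == m) (iota 0 m.+1)) else 0.

Lemma push_at (i : nat -> nat) (b : nat -> C) (n : nat) :
  (forall m n, (m < n)%N -> (i m < i n)%N) -> push i b (i n) = b n.
Proof.
move=> hi.
have hge : forall n, (n <= i n)%N.
  by elim=> // k IH; have := hi _ _ (ltnSn k); lia.
have h : has (fun k => i k == i n) (iota 0 (i n).+1).
  by apply/hasP; exists n => //; rewrite mem_iota; have := hge n; lia.
rewrite /push h; congr b.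
have /eqP := nth_find 0%N h.
rewrite nth_iota; last by rewrite -[X in (_ < X)%N](size_iota 0) -has_find.
rewrite add0n; set m := find _ _ => e.
by case: (ltngtP m n) => // /hi; lia.
Qed.

Lemma push_out (i : nat -> nat) (b : nat -> C) (m : nat) :
  (forall n, i n <> m) -> push i b m = 0.
Proof.
move=> h; rewrite /push; case: ifP => // /hasP [n _ /eqP e].
by case: (h n).
Qed.

Definition summable (a : nat -> C) : Prop := ex_series (fun n => Cmod (a n)).

Lemma push_Cmod (i : nat -> nat) (b : nat -> C) (v : R) :
  (forall m n, (m < n)%N -> (i m < i n)%N) ->
  is_series (fun n => Cmod (b n)) v -> is_series (fun n => Cmod (push i b n)) v.
Proof.
move=> hi; apply: (is_series_reindex i) => //.
- by move=> n; rewrite push_at.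
- by move=> m h; rewrite push_out // Cmod_0.
Qed.

Lemma summable_push (i : nat -> nat) (b : nat -> C) :
  (forall m n, (m < n)%N -> (i m < i n)%N) -> summable b -> summable (push i b).
Proof. by move=> hi [v hv]; exists v; apply: push_Cmod. Qed.

Lemma dseries_push (i : nat -> nat) (b : nat -> C) (s v : C) :
  (forall m n, (m < n)%N -> (i m < i n)%N) ->
  is_series (fun n => Cmult (b n) (npow (i n) s)) v -> dseries_to (push i b) s v.
Proof.
move=> hi; apply: (is_series_reindex i) => //.
- by move=> n; rewrite /dterm push_at.
- by move=> m h; rewrite /dterm push_out // Cmult_0_l.
Qed.

Lemma dseries_plus (a b : nat -> C) (s u v : C) :
  dseries_to a s u -> dseries_to b s v ->
  dseries_to (fun n => Cplus (a n) (b n)) s (Cplus u v).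
Proof.
move=> ha hb; apply: (is_series_ext _ _ _ _ (is_series_plus _ _ _ _ ha hb)).
by move=> n; rewrite /dterm /plus /= Cmult_plus_distr_r.
Qed.

Lemma dseries_scal (c : C) (a : nat -> C) (s v : C) :
  dseries_to a s v -> dseries_to (fun n => Cmult c (a n)) s (Cmult c v).
Proof.
move=> ha; apply: (is_series_ext _ _ _ _ (is_series_scal c _ _ ha)).
by move=> n; rewrite /dterm /scal /= /mult /= Cmult_assoc.
Qed.

Lemma dseries_unique (a : nat -> C) (s u v : C) :
  dseries_to a s u -> dseries_to a s v -> u = v.
Proof. by move=> hu hv; apply: (filterlim_locally_unique _ _ _ hu hv). Qed.

Lemma summable_plus (a b : nat -> C) :
  summable a -> summable b -> summable (fun n => Cplus (a n) (b n)).
Proof.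
move=> ha hb; apply: (@ex_series_le R_AbsRing R_CompleteNormedModule _
  (fun n => Cmod (a n) + Cmod (b n))); last exact: ex_series_plus.
by move=> n; rewrite /norm /= /abs /= Rabs_pos_eq; [apply: Cmod_triangle | apply: Cmod_ge_0].
Qed.

Lemma summable_scal (c : C) (a : nat -> C) :
  summable a -> summable (fun n => Cmult c (a n)).
Proof.
move=> ha; apply: (ex_series_ext (fun n => Cmod c * Cmod (a n))).
  by move=> n; rewrite Cmod_mult.
exact: ex_series_scal.
Qed.

Lemma Cmod_series_le (a : nat -> C) (v : C) (b : nat -> R) :
  is_series a v -> (forall n, Cmod (a n) <= b n) -> ex_series b ->
  Cmod v <= Series b.
Proof.
move=> ha hab [K hK]; rewrite (is_series_unique _ _ hK).
have h1 : is_lim_seq (fun n => norm (sum_n a n)) (norm v).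
  exact: filterlim_comp ha (filterlim_norm v).
change (Rbar_le (@norm C_AbsRing C_NormedModule v) K).
apply: (is_lim_seq_le _ (sum_n b) _ (Finite K) _ h1 hK) => n.
apply: Rle_trans (norm_sum_n_m _ _ _) _.
by apply: sum_n_m_le.
Qed.

Lemma exp_le_compat (x y : R) : x <= y -> exp x <= exp y.
Proof. by case=> [h|->]; [apply/Rlt_le/exp_increasing | apply: Rle_refl]. Qed.

Lemma ln_INR_ge0 (n : nat) : 0 <= ln (INR n.+1).
Proof.
rewrite S_INR; case: (pos_INR n) => [h|<-]; last by rewrite Rplus_0_l ln_1; apply: Rle_refl.
by rewrite -ln_1; apply/Rlt_le/ln_increasing; lra.
Qed.

Lemma ex_dseries (a : nat -> C) (s : C) :
  (0 <= Re s) -> summable a -> exists v, dseries_to a s v.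
Proof.
move=> hs ha; apply: (ex_series_le (V := C_CompleteNormedModule) _ _ _ ha) => n.
rewrite -[X in X <= _]/(Cmod (dterm a s n)) Cmod_mult Cmod_npow.
rewrite -[X in _ <= X]Rmult_1_r; apply: Rmult_le_compat_l; first exact: Cmod_ge_0.
(* The left case is index 0, where [ln 0 = 0] by convention and [npow 0 s] has modulus 1. *)
have [h|h] : ln (INR n) = 0 \/ 0 <= ln (INR n).
  case: n => [|n]; first by left; rewrite /ln; case: Rlt_dec => //= h; case: (Rlt_irrefl 0).
  by right; apply: ln_INR_ge0.
- by rewrite h Rmult_0_r exp_0; apply: Rle_refl.
- by rewrite -exp_0; apply: exp_le_compat; nra.
Qed.

(** * Leading coefficients *)

(** Convergence is stated by components so that the limit rules for real sequences apply
    directly. *)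
Definition Climit (f : nat -> C) (l : C) : Prop :=
  is_lim_seq (fun j => Re (f j)) (Re l) /\ is_lim_seq (fun j => Im (f j)) (Im l).

Lemma Climit_unique (f : nat -> C) (l m : C) : Climit f l -> Climit f m -> l = m.
Proof.
move=> [h1 h2] [h3 h4]; apply: C_eq.
- by have := is_lim_seq_unique _ _ h1; rewrite (is_lim_seq_unique _ _ h3); case.
- by have := is_lim_seq_unique _ _ h2; rewrite (is_lim_seq_unique _ _ h4); case.
Qed.

Lemma Climit_ext_loc (f g : nat -> C) (l : C) (j0 : nat) :
  (forall j, (j0 <= j)%N -> f j = g j) -> Climit f l -> Climit g l.
Proof.
move=> h [h1 h2]; split; [apply: is_lim_seq_ext_loc h1 | apply: is_lim_seq_ext_loc h2];
  by exists j0 => j hj; rewrite h //; lia.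
Qed.

Lemma Climit_const (l : C) : Climit (fun=> l) l.
Proof. by split; apply: is_lim_seq_const. Qed.

Lemma Climit_plus (f g : nat -> C) (l m : C) :
  Climit f l -> Climit g m -> Climit (fun j => Cplus (f j) (g j)) (Cplus l m).
Proof. by move=> [h1 h2] [h3 h4]; split; apply: is_lim_seq_plus'. Qed.

Lemma Climit_mult (f g : nat -> C) (l m : C) :
  Climit f l -> Climit g m -> Climit (fun j => Cmult (f j) (g j)) (Cmult l m).
Proof.
move=> [h1 h2] [h3 h4]; split.
- by apply: is_lim_seq_minus'; apply: is_lim_seq_mult'.
- by apply: is_lim_seq_plus'; apply: is_lim_seq_mult'.
Qed.

Lemma Climit_RtoC (f : nat -> R) (l : R) :
  is_lim_seq f l -> Climit (fun j => RtoC (f j)) (RtoC l).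
Proof. by move=> h; split=> //=; apply: is_lim_seq_const. Qed.

Lemma Rabs_Re_le (z : C) : Rabs (Re z) <= Cmod z.
Proof. by apply: Rle_trans (Rmax_Cmod z); apply: Rmax_l. Qed.

Lemma Rabs_Im_le (z : C) : Rabs (Im z) <= Cmod z.
Proof. by apply: Rle_trans (Rmax_Cmod z); apply: Rmax_r. Qed.

Lemma Climit_le (f : nat -> C) (l : C) (e : nat -> R) (j0 : nat) :
  (forall j, (j0 <= j)%N -> Cmod (Cminus (f j) l) <= e j) -> is_lim_seq e 0 ->
  Climit f l.
Proof.
move=> h he.
have key : forall u : nat -> R, forall v : R,
    (forall j, (j0 <= j)%N -> Rabs (u j - v) <= e j) -> is_lim_seq u v.
  move=> u v huv; apply: (is_lim_seq_le_le_loc (fun j => v - e j) _ (fun j => v + e j)).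
  - exists j0 => j hj; have := huv j; move/(_ ltac:(lia)); by move=> /Rabs_le_between; lra.
  - rewrite -{2}[v]Rminus_0_r; apply: is_lim_seq_minus' he; exact: is_lim_seq_const.
  - rewrite -{2}[v]Rplus_0_r; apply: is_lim_seq_plus' he; exact: is_lim_seq_const.
split; apply: key => j hj; apply: Rle_trans (h j hj).
- exact: (Rabs_Re_le (Cminus (f j) l)).
- exact: (Rabs_Im_le (Cminus (f j) l)).
Qed.

Lemma is_series_single {K : AbsRing} {V : NormedModule K} (m : nat) (x : V) :
  is_series (fun n => if n == m then x else zero) x.
Proof.
have hs : forall n, sum_n (fun n => if n == m then x else zero) n =
    if (m <= n)%N then x else zero.
  elim=> [|n IH]; first by rewrite sum_O leqn0 eq_sym.
  rewrite sum_Sn IH; case: (ltngtP m n.+1) => h.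
  - by rewrite (_ : (m <= n)%N = true) ?plus_zero_r //; lia.
  - by rewrite (_ : (m <= n)%N = false) ?plus_zero_r //; lia.
  - by rewrite h ltnn plus_zero_l.
move=> P hP; exists m => n hn; rewrite hs (_ : (m <= n)%N = true); last by lia.
exact: locally_singleton.
Qed.

(* [j0] absorbs a finite abscissa of absolute convergence. *)
Definition dirichlet_at (b : nat -> C) (j0 : nat) (F : nat -> C) : Prop :=
  b 0%N = 0 /\ ex_series (fun n => Cmod (b n) * (/ INR n) ^ j0) /\
  forall j, (j0 <= j)%N -> dseries_to b (RtoC (INR j)) (F j).

(** After scaling by [M^j] the term at [M] is the constant [b M], and the terms beyond it are at
    most [(M/(M+1))^(j-j0)] times those of a fixed summable series. *)
Lemma leading_coef_limit (b : nat -> C) (j0 : nat) (F : nat -> C) (M : nat) :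
  dirichlet_at b j0 F -> (0 < M)%N -> (forall n, (n < M)%N -> b n = 0) ->
  Climit (fun j => Cmult (RtoC (INR M ^ j)) (F j)) (b M).
Proof.
move=> [_ [hb hF]] hM hlow; have hMp := INR_gt0 _ hM.
set S := Series (fun n => Cmod (b n) * (/ INR n) ^ j0).
(* The largest ratio [M/n] over [n > M]. *)
set th := INR M * / INR M.+1.
have hM1 : 0 < INR M.+1 by apply: INR_gt0.
have hth : 0 <= th < 1.
  split; first by apply: Rmult_le_pos; [lra | apply/Rlt_le/Rinv_0_lt_compat].
  apply: (Rmult_lt_reg_r (INR M.+1)) => //.
  by rewrite /th Rmult_assoc Rinv_l ?S_INR; lra.
apply: (Climit_le _ _ (fun j => INR M ^ j0 * S * th ^ (j - j0)) j0); last first.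
  rewrite -(Rmult_0_r (INR M ^ j0 * S)).
  apply: is_lim_seq_mult'; first exact: is_lim_seq_const.
  apply/(is_lim_seq_incr_n _ j0).
  apply: (is_lim_seq_ext (fun j => th ^ j)); first by move=> j; congr (th ^ _); lia.
  by apply: is_lim_seq_geom; rewrite Rabs_pos_eq; lra.
move=> j hj.
have h1 := is_series_minus _ _ _ _ (hF j hj) (is_series_single M (dterm b (RtoC (INR j)) M)).
have h2 := is_series_scal (RtoC (INR M ^ j)) _ _ h1.
have -> : Cminus (Cmult (RtoC (INR M ^ j)) (F j)) (b M) =
  scal (RtoC (INR M ^ j)) (plus (F j) (opp (dterm b (RtoC (INR j)) M))).
  rewrite /scal /= /mult /= /plus /opp /= /dterm npow_INR // -[X in Cminus _ X]Cmult_1_r.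
  have -> : RtoC 1 = Cmult (RtoC (INR M ^ j)) (RtoC ((/ INR M) ^ j)).
    by rewrite -RtoC_mult -Rpow_mult_distr Rinv_r ?pow1 //; lra.
  ring.
have -> : INR M ^ j0 * S * th ^ (j - j0) =
    Series (fun n => INR M ^ j0 * th ^ (j - j0) * (Cmod (b n) * (/ INR n) ^ j0)).
  by rewrite Series_scal_l -/S; ring.
apply: Cmod_series_le h2 _ _; last exact: ex_series_scal.
move=> n; rewrite /scal /= /mult /= Cmod_mult Cmod_R Rabs_pos_eq; last by apply: pow_le; lra.
have hpos : 0 <= INR M ^ j0 * th ^ (j - j0) by apply: Rmult_le_pos; apply: pow_le; lra.
rewrite /plus /opp /=.
case: (ltngtP n M) => h.
- rewrite /dterm hlow // Cmult_0_l Copp_0 Cplus_0_l Cmod_0; lra.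
- have hn : (0 < n)%N by lia.
  have hnp := INR_gt0 _ hn.
  rewrite Copp_0 Cplus_0_r /dterm npow_INR // Cmod_mult Cmod_R.
  have hi : 0 < / INR n by apply: Rinv_0_lt_compat.
  rewrite Rabs_pos_eq; last by apply: pow_le; lra.
  (* The first [j0] powers keep the dominating series summable; the remaining [j - j0] give the
     geometric decay. *)
  have e : j = (j0 + (j - j0))%coq_nat by lia.
  rewrite {1 2}e !pow_add.
  have hq : (INR M) ^ (j - j0) * (/ INR n) ^ (j - j0) <= th ^ (j - j0).
    rewrite -Rpow_mult_distr; apply: pow_incr; split; first by apply: Rmult_le_pos; lra.
    apply: Rmult_le_compat_l; first lra.
    apply: Rinv_le_contravar => //; apply: le_INR; lia.
  have hc : 0 <= INR M ^ j0 * (Cmod (b n) * (/ INR n) ^ j0).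
    apply: Rmult_le_pos; first by apply: pow_le; lra.
    apply: Rmult_le_pos; [exact: Cmod_ge_0 | apply: pow_le; lra].
  have := Rmult_le_compat_l _ _ _ hc hq; lra.
- rewrite h Cplus_opp_r Cmod_0 Rmult_0_r; apply: Rmult_le_pos => //.
  apply: Rmult_le_pos; [exact: Cmod_ge_0 | apply: pow_le].
  by apply/Rlt_le/Rinv_0_lt_compat.
Qed.

(** The lower coefficients need not be known to vanish. If [M^j F_j] converges, then for [n < M] the
    factor [(n/M)^j] sends [n^j F_j] to 0, so strong induction kills every [b n] below [M]. *)
Lemma leading_coef_unique (b : nat -> C) (j0 : nat) (F : nat -> C) (M : nat) (l : C) :
  dirichlet_at b j0 F -> (0 < M)%N ->
  Climit (fun j => Cmult (RtoC (INR M ^ j)) (F j)) l -> b M = l.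
Proof.
move=> hb hM hl; have hMp := INR_gt0 _ hM.
suff hlow : forall n, (n < M)%N -> b n = 0.
  by apply: Climit_unique hl; apply: leading_coef_limit hb hM hlow.
elim/ltn_ind => n IH hn; case: (posnP n) => [->|hn0]; first by case: hb.
have hnp := INR_gt0 _ hn0.
have h1 := leading_coef_limit _ _ _ _ hb hn0 (fun m hm => IH m hm (ltn_trans hm hn)).
apply: Climit_unique h1 _; rewrite -(Cmult_0_l l).
apply: (Climit_ext_loc
  (fun j => Cmult (RtoC ((INR n * / INR M) ^ j)) (Cmult (RtoC (INR M ^ j)) (F j))) _ _ 0).
  move=> j _; rewrite Cmult_assoc -RtoC_mult -Rpow_mult_distr Rmult_assoc Rinv_l; last lra.
  by rewrite Rmult_1_r.
apply: Climit_mult => //; apply: Climit_RtoC; apply: is_lim_seq_geom.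
have hi : 0 < / INR M by apply: Rinv_0_lt_compat.
rewrite Rabs_pos_eq; last by apply: Rmult_le_pos; lra.
apply: (Rmult_lt_reg_r (INR M)) => //.
rewrite Rmult_assoc Rinv_l ?Rmult_1_r ?Rmult_1_l; last lra.
by apply: lt_INR; lia.
Qed.

(** * Disjoint supports *)

Lemma Series_eq_termwise (u v : nat -> R) :
  (forall n, u n <= v n) -> ex_series u -> ex_series v -> Series u = Series v ->
  forall n, u n = v n.
Proof.
move=> h hu hv e n; apply: Rle_antisym; first exact: h.
(* The nonnegative series of [v - u] has sum 0 and dominates its own term at [n]. *)
have hs : Series (fun k => if k == n then v n - u n else 0) <= Series (fun k => v k - u k).
  apply: Series_le; last exact: ex_series_minus.
  move=> k; have := h k; have := h n.
  by case: eqVneq => [->|_]; lra.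
have := is_series_unique _ _ (is_series_single (V := R_NormedModule) n (v n - u n)).
rewrite Series_minus // in hs; rewrite /zero /= => hd; lra.
Qed.

(* Parallelogram law. *)
Lemma Cmod_plus_minus_eq (x y : C) :
  Cmod (Cplus x y) = Cmod x + Cmod y -> Cmod (Cminus x y) = Cmod x + Cmod y ->
  x = 0 \/ y = 0.
Proof.
move=> hp hm.
have sq : forall z : C, Cmod z ^ 2 = Re z ^ 2 + Im z ^ 2.
  by move=> z; rewrite /Cmod -/(Re z) -/(Im z) pow2_sqrt //; nra.
have h0 : Cmod x * Cmod y = 0.
  have := sq (Cplus x y); have := sq (Cminus x y); rewrite hp hm.
  have := sq x; have := sq y; case: x {hp hm} => a b; case: y => c d /=; nra.
by case: (Rmult_integral _ _ h0) => /Cmod_eq_0; [left | right].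
Qed.

Lemma Cmult_m1 (c : C) : Cmult (-1) c = Copp c.
Proof. by case: c => x y; apply: C_eq => /=; ring. Qed.

(** Equality in the triangle inequality for the norm forces equality in every coefficient. Having it
    for both signs is what the parallelogram law excludes unless one coefficient is zero. *)
Lemma disjoint_supports (x y : nat -> C) :
  summable x -> summable y ->
  normA (fun n => Cplus (x n) (y n)) = normA x + normA y ->
  normA (fun n => Cplus (x n) (Cmult (-1) (y n))) = normA x + normA y ->
  forall n, x n = 0 \/ y n = 0.
Proof.
move=> hx hy; rewrite /normA -Series_plus // => hp hm n.
have hxy := ex_series_plus _ _ hx hy.
(* [z] stands for both [y] and its negative. *)
have key : forall z, (forall n, Cmod (z n) <= Cmod (y n)) -> summable z ->
    Series (fun n => Cmod (Cplus (x n) (z n))) = Series (fun n => Cmod (x n) + Cmod (y n)) ->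
    forall n, Cmod (Cplus (x n) (z n)) = Cmod (x n) + Cmod (y n).
  move=> z hz sz; apply: Series_eq_termwise => //; last exact: summable_plus.
  move=> k; apply: Rle_trans (Cmod_triangle _ _) _; have := hz k; lra.
apply: Cmod_plus_minus_eq; first by apply: (key y) => // k; apply: Rle_refl.
rewrite /Cminus -Cmult_m1; apply: (key (fun n => Cmult (-1) (y n))) => //; last exact: summable_scal.
by move=> k; rewrite Cmult_m1 Cmod_opp; apply: Rle_refl.
Qed.

(** The coefficient sequence of the monomial [m^{-s}]; the isometry is tested on these and on
    combinations of two of them. *)
Definition delta (m n : nat) : C := if n == m then 1 else 0.

Lemma dseries_delta (m : nat) (s : C) : dseries_to (delta m) s (npow m s).
Proof.
apply: is_series_ext (is_series_single m (npow m s)) => n.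
by rewrite /dterm /delta; case: eqVneq => [->|_]; rewrite ?Cmult_1_l ?Cmult_0_l.
Qed.

Lemma is_series_delta (m : nat) : is_series (fun n => Cmod (delta m n)) 1.
Proof.
apply: is_series_ext (is_series_single (V := R_NormedModule) m 1) => n.
by rewrite /delta; case: eqP; rewrite ?Cmod_1 ?Cmod_0.
Qed.

Lemma in_Akplus_delta (k m : nat) : smooth k m -> in_Akplus k (delta m).
Proof.
move=> hm; split; last by exists 1; apply: is_series_delta.
by move=> n hn; rewrite /delta; case: eqP => // e; move: hn; rewrite e hm.
Qed.

Lemma normA_delta (m : nat) : normA (delta m) = 1.
Proof. exact: is_series_unique (is_series_delta m). Qed.

Lemma normA_delta_plus (m m' : nat) (c : C) : m <> m' -> Cmod c = 1 ->
  normA (fun n => Cplus (delta m n) (Cmult c (delta m' n))) = 2.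
Proof.
move=> hm hc; apply: is_series_unique.
have -> : 2 = 1 + 1 by ring.
apply: is_series_ext (is_series_plus _ _ _ _ (is_series_delta m) (is_series_delta m')) => n.
rewrite /delta /plus /=; case: eqP => [->|_].
  by case: eqP => [/hm|] //; rewrite Cmult_0_r Cplus_0_r Cmod_0 Rplus_0_r.
by rewrite Cplus_0_l Cmod_mult hc Cmod_0 Rplus_0_l Rmult_1_l.
Qed.

Lemma in_Akplus_plus (k : nat) (a b : nat -> C) :
  in_Akplus k a -> in_Akplus k b -> in_Akplus k (fun n => Cplus (a n) (b n)).
Proof.
move=> [ha sa] [hb sb]; split; last exact: summable_plus.
by move=> n hn; rewrite ha // hb // Cplus_0_l.
Qed.

Lemma in_Akplus_scal (k : nat) (c : C) (a : nat -> C) :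
  in_Akplus k a -> in_Akplus k (fun n => Cmult c (a n)).
Proof.
move=> [ha sa]; split; last exact: summable_scal.
by move=> n hn; rewrite ha // Cmult_0_r.
Qed.

Lemma comp_rel_delta (phi : C -> C) (m : nat) (b : nat -> C) (s : C) :
  comp_rel phi (delta m) b -> 0 < Re s -> dseries_to b s (npow m (phi s)).
Proof. by move=> h hs; apply: h => //; apply: dseries_delta. Qed.

(** [comp_rel] speaks only of points where the source series converges, so it is not additive for
    free. Monomials converge everywhere, and uniqueness of sums identifies [v]. *)
Lemma comp_rel_delta_plus (phi : C -> C) (m m' : nat) (c : C) (b b' : nat -> C) :
  comp_rel phi (delta m) b -> comp_rel phi (delta m') b' ->
  comp_rel phi (fun n => Cplus (delta m n) (Cmult c (delta m' n)))
    (fun n => Cplus (b n) (Cmult c (b' n))).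
Proof.
move=> hb hb' s hs v hv.
rewrite (dseries_unique _ _ _ _ hv (dseries_plus _ _ _ _ _ (dseries_delta m _)
  (dseries_scal c _ _ _ (dseries_delta m' _)))).
by apply: dseries_plus; [|apply: dseries_scal]; apply: comp_rel_delta.
Qed.

(** Both [c = 1] and [c = -1] give combinations of norm 2 before composition, hence after it, while
    each image alone has norm 1. *)
Lemma isometry_disjoint (k : nat) (phi : C -> C) (m m' : nat) (b b' : nat -> C) :
  (forall a b : nat -> C, in_Akplus k a -> in_Akplus k b -> comp_rel phi a b ->
     normA b = normA a) ->
  smooth k m -> smooth k m' -> m <> m' ->
  in_Akplus k b -> comp_rel phi (delta m) b ->
  in_Akplus k b' -> comp_rel phi (delta m') b' ->
  forall n, b n = 0 \/ b' n = 0.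
Proof.
move=> iso hm hm' ne hb cb hb' cb'.
have dm := in_Akplus_delta _ _ hm; have dm' := in_Akplus_delta _ _ hm'.
have key : forall c : C, Cmod c = 1 ->
    normA (fun n => Cplus (b n) (Cmult c (b' n))) = normA b + normA b'.
  move=> c hc; rewrite (iso _ _ dm hb cb) (iso _ _ dm' hb' cb') !normA_delta.
  have -> : 1 + 1 = 2 by ring.
  rewrite -(normA_delta_plus m m' c) //; apply: iso.
  - by apply: in_Akplus_plus => //; apply: in_Akplus_scal.
  - by apply: in_Akplus_plus => //; apply: in_Akplus_scal.
  - exact: comp_rel_delta_plus.
apply: disjoint_supports; [by case: hb | by case: hb' | |].
- rewrite -(key 1); last exact: Cmod_1.
  by apply: Series_ext => n; rewrite Cmult_1_l.
- by apply: key; rewrite Cmod_R Rabs_Ropp Rabs_R1.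
Qed.

(* At [n = 0] this relies on [/ 0 = 0]. *)
Lemma inv_INR_bounds (n : nat) : 0 <= / INR n <= 1.
Proof.
case: n => [|n]; first by rewrite /= Rinv_0; lra.
have h : 1 <= INR n.+1 by rewrite S_INR; have := pos_INR n; lra.
split; first by apply/Rlt_le/Rinv_0_lt_compat; lra.
by rewrite -Rinv_1; apply: Rinv_le_contravar; lra.
Qed.

(** * Linearity and uniqueness for Dirichlet series sampled at natural numbers *)

Lemma dirichlet_at_plus (a b : nat -> C) (j0 : nat) (F G : nat -> C) :
  dirichlet_at a j0 F -> dirichlet_at b j0 G ->
  dirichlet_at (fun n => Cplus (a n) (b n)) j0 (fun j => Cplus (F j) (G j)).
Proof.
move=> [a0 [sa ha]] [b0 [sb hb]]; split; first by rewrite a0 b0 Cplus_0_l.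
split; last by move=> j hj; apply: dseries_plus; auto.
apply: (@ex_series_le R_AbsRing R_CompleteNormedModule _ _ _ (ex_series_plus _ _ sa sb)) => n.
have h : 0 <= (/ INR n) ^ j0.
  by apply: pow_le; case: (inv_INR_bounds n).
rewrite /norm /= /abs /= Rabs_pos_eq; last by apply: Rmult_le_pos => //; apply: Cmod_ge_0.
rewrite /plus /= -Rmult_plus_distr_r; apply: Rmult_le_compat_r => //; exact: Cmod_triangle.
Qed.

Lemma dirichlet_at_scal (c : C) (a : nat -> C) (j0 : nat) (F : nat -> C) :
  dirichlet_at a j0 F -> dirichlet_at (fun n => Cmult c (a n)) j0 (fun j => Cmult c (F j)).
Proof.
move=> [a0 [sa ha]]; split; first by rewrite a0 Cmult_0_r.
split; last by move=> j hj; apply: dseries_scal; auto.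
apply: (ex_series_ext (fun n => Cmod c * (Cmod (a n) * (/ INR n) ^ j0))).
  by move=> n; rewrite Cmod_mult Rmult_assoc.
exact: ex_series_scal.
Qed.

(** The difference represents zero, so all its scaled limits are 0: the values at large natural
    numbers already determine the coefficients. *)
Lemma dirichlet_at_unique (a b : nat -> C) (j0 : nat) (F : nat -> C) :
  dirichlet_at a j0 F -> dirichlet_at b j0 F -> forall n, a n = b n.
Proof.
move=> ha hb n; case: (posnP n) => [->|hn]; first by case: ha => -> _; case: hb.
have := leading_coef_unique _ _ _ n 0
  (dirichlet_at_plus _ _ _ _ _ ha (dirichlet_at_scal (-1) _ _ _ hb)) hn.
have h0 : Climit (fun j => Cmult (RtoC (INR n ^ j)) (Cplus (F j) (Cmult (-1) (F j)))) 0.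
  apply: (Climit_ext_loc (fun=> 0) _ _ 0) (Climit_const _) => j _.
  by rewrite Cmult_m1 Cplus_opp_r Cmult_0_r.
move=> /(_ h0); rewrite Cmult_m1 => h.
have -> : a n = Cplus (Cplus (a n) (Copp (b n))) (b n) by ring.
by rewrite h Cplus_0_l.
Qed.

Lemma dirichlet_at_summable (b : nat -> C) (j0 : nat) (F : nat -> C) :
  b 0%N = 0 -> summable b ->
  (forall j, (j0 <= j)%N -> dseries_to b (RtoC (INR j)) (F j)) -> dirichlet_at b j0 F.
Proof.
move=> b0 sb hF; split=> //; split=> //.
apply: (@ex_series_le R_AbsRing R_CompleteNormedModule _ _ _ sb) => n.
have h : 0 <= (/ INR n) ^ j0 <= 1.
  have hi := inv_INR_bounds n.
  split; first by apply: pow_le; case: hi.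
  by rewrite -(pow1 j0); apply: pow_incr.
have h0 := Cmod_ge_0 (b n).
rewrite /norm /= /abs /= Rabs_pos_eq; nra.
Qed.

Lemma Akplus_0 (k : nat) (b : nat -> C) : in_Akplus k b -> b 0%N = 0.
Proof. by case=> h _; apply: h. Qed.

(** * The coefficients of [psi] *)

(** Write [f x - f 0 = q x * x] with [q] continuous at 0, and pass to the limit in each factor. *)
Lemma derivable_scaled_limit (f : R -> R) (d : R) (lam x : nat -> R) (a : R) :
  derivable_pt_lim f 0 d -> is_lim_seq x 0 -> is_lim_seq (fun j => lam j * x j) a ->
  is_lim_seq (fun j => lam j * (f (x j) - f 0)) (d * a).
Proof.
move=> hf hx hl.
(* The difference quotient, completed by the derivative at 0 because some [x j] may be 0. *)
pose q h := if Req_EM_T h 0 then d else (f h - f 0) / h.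
have q0 : q 0 = d by rewrite /q; case: Req_EM_T.
have hq : continuity_pt q 0.
  move=> eps heps; have [del hdel] := hf eps heps; exists del; split; first exact: cond_pos.
  move=> h [_]; rewrite /dist /= /Rdist q0 Rminus_0_r => hh.
  rewrite /q; case: (Req_EM_T h 0) => [e|h0]; first by rewrite Rminus_diag Rabs_R0.
  by have := hdel h h0 hh; rewrite Rplus_0_l.
have := is_lim_seq_mult' _ _ _ _ (is_lim_seq_continuous q x 0 hq hx) hl.
rewrite q0; apply: is_lim_seq_ext => j.
rewrite /q; case: (Req_EM_T (x j) 0) => [e|h0] /=; first by rewrite e; ring.
by field.
Qed.

Lemma Climit_cexp (f : nat -> C) (l : C) :
  Climit f l -> Climit (fun j => cexp (f j)) (cexp l).
Proof.
have hexp : continuity exp by apply: derivable_continuous; exact: derivable_exp.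
move=> [h1 h2]; split; apply: is_lim_seq_mult';
  apply: (is_lim_seq_continuous _ _ _ _ _) => //.
- exact: continuity_cos.
- exact: continuity_sin.
Qed.

(** To first order [e^z - 1] is [z]. This carries the leading coefficient of an exponent over to its
    exponential. *)
Lemma cexp_scaled_limit (lam : nat -> R) (z : nat -> C) (w : C) :
  Climit z 0 -> Climit (fun j => Cmult (RtoC (lam j)) (z j)) w ->
  Climit (fun j => Cmult (RtoC (lam j)) (Cminus (cexp (z j)) 1)) w.
Proof.
move=> [zr zi] [wr wi].
have {}wr : is_lim_seq (fun j => lam j * Re (z j)) (Re w).
  by apply: is_lim_seq_ext wr => j; rewrite /Re /Im /=; ring.
have {}wi : is_lim_seq (fun j => lam j * Im (z j)) (Im w).
  by apply: is_lim_seq_ext wi => j; rewrite /Re /Im /=; ring.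
have he := derivable_scaled_limit _ _ _ _ _ (derivable_pt_lim_exp 0) zr wr.
have hs := derivable_scaled_limit _ _ _ _ _ derivable_pt_lim_sin_0 zi wi.
have hc := derivable_scaled_limit _ _ _ _ _ derivable_pt_lim_cos_0 zi wi.
have hexp : is_lim_seq (fun j => exp (Re (z j))) (exp 0).
  apply: (is_lim_seq_continuous _ _ _ _ zr).
  by apply: derivable_continuous; exact: derivable_exp.
have hcos : is_lim_seq (fun j => cos (Im (z j))) (cos 0).
  by apply: (is_lim_seq_continuous _ _ _ _ zi); exact: continuity_cos.
split.
(* The real part [e^a cos b - 1] is split as [(e^a - 1) cos b + (cos b - 1)]; the second summand
   contributes nothing, as the cosine has derivative 0 at 0. *)
- have := is_lim_seq_plus' _ _ _ _ (is_lim_seq_mult' _ _ _ _ he hcos) hc.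
  rewrite exp_0 cos_0 (_ : 1 * Re w * 1 + 0 * Im w = Re w); last by ring.
  by apply: is_lim_seq_ext => j; rewrite /cexp /Re /Im /=; ring.
- have := is_lim_seq_mult' _ _ _ _ hexp hs.
  rewrite exp_0 sin_0 (_ : 1 * (1 * Im w) = Im w); last by ring.
  by apply: is_lim_seq_ext => j; rewrite /cexp /Re /Im /=; ring.
Qed.

(** Comparison with the telescoping series of [1/(n+1) - 1/(n+2)], after dropping the indices 0 and
    1. *)
Lemma ex_series_inv_sqr : ex_series (fun n => (/ INR n) ^ 2).
Proof.
apply/(ex_series_incr_n _ 2).
have hs : ex_series (fun n => / INR n.+1 - / INR n.+2).
  exists 1.
  have e : forall n, sum_n (fun n => / INR n.+1 - / INR n.+2) n = 1 - / INR n.+2.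
    elim=> [|n IH]; first by rewrite sum_O /=; field.
    rewrite sum_Sn IH /plus /=; ring.
  suff h : is_lim_seq (sum_n (fun n => / INR n.+1 - / INR n.+2)) 1 by exact: h.
  apply: (is_lim_seq_ext (fun n => 1 - / INR n.+2)); first by move=> n; rewrite e.
  rewrite -{2}(Rminus_0_r 1); apply: is_lim_seq_minus'; first exact: is_lim_seq_const.
  apply: (is_lim_seq_inv _ p_infty) => //.
  apply: (is_lim_seq_ext (fun n => INR (n + 2)%coq_nat)); first by move=> n; congr INR; lia.
  by apply/(is_lim_seq_incr_n INR 2); exact: is_lim_seq_INR.
apply: (ex_series_le (V := R_CompleteNormedModule) _ _ _ hs) => n.
change (Rabs ((/ INR n.+2) ^ 2) <= / INR n.+1 - / INR n.+2).
rewrite Rabs_pos_eq; last exact: pow2_ge_0.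
have h1 : 1 <= INR n.+1 by rewrite S_INR; have := pos_INR n; lra.
rewrite (S_INR n.+1); set x := INR n.+1 in h1 *.
have -> : / x - / (x + 1) = / (x * (x + 1)) by field; lra.
by rewrite pow_inv; apply: Rinv_le_contravar; nra.
Qed.

(** Convergence at one natural number [j1] bounds the terms there, and two further powers of [1/n]
    give absolute convergence by comparison with [1/n^2]; hence the witness [j1 + 2]. *)
Lemma in_Dk_dirichlet (k : nat) (f : C -> C) : in_Dk k f ->
  exists (c : nat -> C) (j0 : nat) (sigma : R), supported_k k c /\ (0 < j0)%N /\
    dirichlet_at c j0 (fun j => f (RtoC (INR j))) /\
    forall s : C, sigma < Re s -> dseries_to c s (f s).
Proof.
move=> [_ [c [hc [sigma hs]]]].
have [j1 hj1] := INR_unbounded sigma.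
have hj : forall j, (j1 <= j)%N -> sigma < Re (RtoC (INR j)).
  move=> j hj /=; apply: Rlt_le_trans hj1 _; apply: le_INR; lia.
exists c, j1.+2, sigma; split=> //; split=> //; split=> //.
split; first exact: hc.
split; last by move=> j hj2; apply/hs/hj; lia.
have hcv : ex_series (dterm c (RtoC (INR j1))).
  by exists (f (RtoC (INR j1))); apply/hs/hj.
have [N hN] := Cauchy_ex_series (V := C_CompleteNormedModule) _ hcv (mkposreal 1 Rlt_0_1).
apply/(ex_series_incr_n _ N.+1).
have hsq := proj1 (ex_series_incr_n _ N.+1) ex_series_inv_sqr.
apply: (ex_series_le (V := R_CompleteNormedModule) _ _ _ hsq) => n.
set m := (N.+1 + n)%coq_nat.
change (Rabs (Cmod (c m) * (/ INR m) ^ j1.+2) <= (/ INR m) ^ 2).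
have hm : (N.+1 <= m)%coq_nat by rewrite /m; lia.
clearbody m; have hm0 : (0 < m)%N by lia.
(* A Cauchy block of length one: the single term at [m] has modulus below 1. *)
have := hN m m; rewrite sum_n_n => /(_ ltac:(lia) ltac:(lia)).
rewrite -[norm _]/(Cmod (dterm c (RtoC (INR j1)) m)) /dterm npow_INR // Cmod_mult Cmod_R /=.
have hi : 0 <= / INR m by case: (inv_INR_bounds m).
have hp : 0 <= (/ INR m) ^ j1 by apply: pow_le.
rewrite (Rabs_pos_eq _ hp) => h1; have h0 := Cmod_ge_0 (c m).
rewrite Rabs_pos_eq; last by repeat apply: Rmult_le_pos.
have h2 : 0 <= / INR m * / INR m by apply: Rmult_le_pos.
nra.
Qed.

(** * Monomials, shifts of the index, and leading coefficients of images *)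

Lemma dirichlet_at_delta (m j0 : nat) : (0 < m)%N ->
  dirichlet_at (delta m) j0 (fun j => RtoC ((/ INR m) ^ j)).
Proof.
move=> hm; apply: dirichlet_at_summable.
- by rewrite /delta; case: eqP => // e; lia.
- by exists 1; apply: is_series_delta.
- by move=> j _; rewrite -npow_INR //; apply: dseries_delta.
Qed.

Lemma dirichlet_at_ext (b : nat -> C) (j0 : nat) (F G : nat -> C) :
  (forall j, (j0 <= j)%N -> F j = G j) -> dirichlet_at b j0 F -> dirichlet_at b j0 G.
Proof.
move=> h [b0 [sb hb]]; split=> //; split=> // j hj.
by rewrite -h //; apply: hb.
Qed.

Lemma muln_incr (Q : nat) : (0 < Q)%N -> forall m n, (m < n)%N -> (Q * m < Q * n)%N.
Proof. by move=> hQ m n; rewrite ltn_pmul2l. Qed.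

Lemma dirichlet_at_push (Q : nat) (b : nat -> C) (j0 : nat) (F : nat -> C) :
  (0 < Q)%N -> dirichlet_at b j0 F ->
  dirichlet_at (push (muln Q) b) j0 (fun j => Cmult (RtoC ((/ INR Q) ^ j)) (F j)).
Proof.
move=> hQ [b0 [sb hb]]; have hi := muln_incr _ hQ.
have h0 : push (muln Q) b 0 = 0 by rewrite -{1}(muln0 Q) push_at.
split=> //; split.
- have [v hv] := ex_series_scal ((/ INR Q) ^ j0) _ sb; exists v.
  apply: (is_series_reindex (muln Q)) hv => //.
  + move=> n; rewrite push_at // mult_INR Rinv_mult Rpow_mult_distr /scal /= /mult /=; ring.
  + by move=> m hm; rewrite push_out // Cmod_0 Rmult_0_l.
- move=> j hj; apply: dseries_push => //.
  have := is_series_scal (RtoC ((/ INR Q) ^ j)) _ _ (hb j hj).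
  apply: is_series_ext => n; rewrite /scal /= /mult /=.
  case: (posnP n) => [->|hn]; first by rewrite /dterm b0 !Cmult_0_l Cmult_0_r.
  by rewrite npow_mul // /dterm -(npow_INR Q) //; ring.
Qed.

Lemma smooth_mul (k m n : nat) : smooth k m -> smooth k n -> smooth k (m * n).
Proof.
move=> /andP [hm am] /andP [hn an]; apply/andP; split; first by rewrite muln_gt0 hm.
apply/allP => p; rewrite primesM // => /orP [] h; [exact: (allP am) | exact: (allP an)].
Qed.

Lemma smooth1 (k : nat) : smooth k 1.
Proof. by []. Qed.

Lemma smooth2 (k : nat) : (1 <= k)%N -> smooth k 2.
Proof. by move=> hk; rewrite /smooth /=; rewrite andbT. Qed.

Lemma smooth_expn (k m i : nat) : smooth k m -> smooth k (m ^ i).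
Proof. by move=> hm; elim: i => [|i IH]; rewrite ?expn0 // expnS; apply: smooth_mul. Qed.

Lemma Climit_pow (f : nat -> C) (l : C) (r : nat) :
  Climit f l -> Climit (fun j => Cpow (f j) r) (Cpow l r).
Proof.
move=> h; elim: r => [|r IH]; first exact: Climit_const.
exact: Climit_mult.
Qed.

(** The factor [m^{-c0 s}] scales out and [psi] tends to [c 1], so the coefficient is
    [npow m (c 1)], a value of the exponential. *)
Lemma leading_coef_npow (c0 : nat) (psi : C -> C) (c : nat -> C) (j0 m : nat)
    (b : nat -> C) :
  dirichlet_at c j0 (fun j => psi (RtoC (INR j))) -> (0 < m)%N ->
  dirichlet_at b j0 (fun j => npow m (Cplus (Cmult (RtoC (INR c0)) (RtoC (INR j)))
                                       (psi (RtoC (INR j))))) ->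
  b (m ^ c0)%N <> 0.
Proof.
move=> hc hm hb.
have hpsi : Climit (fun j => psi (RtoC (INR j))) (c 1%N).
  have hlow : forall n, (n < 1)%N -> c n = 0 by case=> // _; case: hc.
  have := leading_coef_limit _ _ _ 1 hc (ltnSn 0) hlow.
  apply: (Climit_ext_loc _ _ _ 0) => j _.
  by rewrite pow1 Cmult_1_l.
have hM : (0 < m ^ c0)%N by rewrite expn_gt0 hm.
have hMp := INR_gt0 _ hM.
rewrite (leading_coef_unique _ _ _ _ (npow m (c 1%N)) hb hM); first exact: npow_neq0.
apply: (Climit_ext_loc (fun j => npow m (psi (RtoC (INR j)))) _ _ 0).
  move=> j _; rewrite npowD -npow_expn // npow_INR // Cmult_assoc -RtoC_mult.
  by rewrite -Rpow_mult_distr Rinv_r ?pow1 ?Cmult_1_l //; lra.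
rewrite npowE; apply: (Climit_ext_loc
  (fun j => cexp (Cmult (RtoC (- ln (INR m))) (psi (RtoC (INR j))))) _ _ 0).
  by move=> j _; rewrite npowE RtoC_opp; congr cexp; ring.
have -> : Copp (Cmult (c 1%N) (RtoC (ln (INR m)))) = Cmult (RtoC (- ln (INR m))) (c 1%N).
  by rewrite RtoC_opp; ring.
by apply: Climit_cexp; apply: Climit_mult => //; apply: Climit_const.
Qed.

(** * Finite differences of powers *)

Lemma npow_INR_mul (n i : nat) (s : C) :
  npow n (Cmult (RtoC (INR i)) s) = Cpow (npow n s) i.
Proof.
elim: i => [|i IH]; first by rewrite Cmult_0_l npowE Cmult_0_l Copp_0 cexp0.
by rewrite S_INR RtoC_plus Cmult_plus_distr_r npowD IH Cmult_1_l Cpow_S Cmult_comm.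
Qed.

(** Induction on [r] through [w^i (1-w)^(r+1) = w^i (1-w)^r - w^(i+1) (1-w)^r]. The first series is
    multiplied by [Q^{-s}] to match the powers of [Q], which moves its vanishing coefficient to the
    index where the second one vanishes. *)
Lemma dirichlet_at_differences (Q P j0 : nat) (w : nat -> C) : (0 < Q)%N ->
  (forall i, exists b, dirichlet_at b j0
     (fun j => Cmult (Cpow (RtoC ((/ INR Q) ^ j)) i) (Cpow (w j) i)) /\
     b (Q ^ i * P)%N = 0) ->
  forall r i, exists b, dirichlet_at b j0
     (fun j => Cmult (Cpow (RtoC ((/ INR Q) ^ j)) (i + r)%N)
        (Cmult (Cpow (w j) i) (Cpow (Cminus 1 (w j)) r))) /\
     b (Q ^ (i + r) * P)%N = 0.
Proof.
move=> hQ h; elim=> [|r IH] i.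
  have [b [hb b0]] := h i; exists b; rewrite addn0; split=> //.
  by apply: dirichlet_at_ext hb => j _; rewrite /= Cmult_1_r.
have [b [hb b0]] := IH i; have [b' [hb' b0']] := IH i.+1.
exists (fun n => Cplus (push (muln Q) b n) (Cmult (-1) (b' n))); split.
  apply: dirichlet_at_ext (dirichlet_at_plus _ _ _ _ _ (dirichlet_at_push _ _ _ _ hQ hb)
    (dirichlet_at_scal (-1) _ _ _ hb')) => j _.
  by rewrite addnS addSn Cmult_m1 !Cpow_S; ring.
rewrite addnS -addSn b0' Cmult_0_r Cplus_0_r addSn expnS -mulnA push_at //.
exact: muln_incr.
Qed.

Lemma leading_difference_zero (Q N c0 j0 : nat) (w : nat -> C) (d : C) :
  (0 < Q)%N -> (0 < N)%N ->
  (forall i, exists b, dirichlet_at b j0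
     (fun j => Cmult (Cpow (RtoC ((/ INR Q) ^ j)) i) (Cpow (w j) i)) /\
     b (Q ^ i * N ^ c0)%N = 0) ->
  Climit (fun j => Cmult (RtoC (INR N ^ j)) (Cminus 1 (w j))) d -> d = 0.
Proof.
move=> hQ hN h hd.
(* The order [r = c0] is chosen because [(1-w)^r] then starts at [N^c0], exactly where the
   coefficient is known to vanish. *)
have [b [hb b0]] := dirichlet_at_differences _ _ _ _ hQ h c0 0.
rewrite add0n in b0.
have hM : (0 < Q ^ c0 * N ^ c0)%N by rewrite muln_gt0 !expn_gt0 hQ hN.
have hl := leading_coef_unique _ _ _ _ (Cpow d c0) hb hM.
case: (Ceq_dec d 0) => // d0; case: (Cpow_nz _ c0 d0).
rewrite -b0 hl //; apply: (Climit_ext_loc _ _ _ 0) (Climit_pow _ _ c0 hd) => j _.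
have hq := INR_gt0 _ hQ.
have e : RtoC 1 = Cmult (RtoC (INR Q ^ j)) (RtoC ((/ INR Q) ^ j)).
  by rewrite -RtoC_mult -Rpow_mult_distr Rinv_r ?pow1 //; lra.
have e' : Cmult (Cpow (RtoC (INR Q ^ j)) c0) (Cpow (RtoC ((/ INR Q) ^ j)) c0) = 1.
  by rewrite -Cpow_mult_l -e Cpow_1_l.
rewrite add0n Cpow_mult_l mult_INR !INR_expn Rpow_mult_distr RtoC_mult.
rewrite -!pow_mult !(Nat.mul_comm c0 j) !pow_mult (RtoC_pow (INR Q ^ j)) (RtoC_pow (INR N ^ j)).
set x := Cpow (Cminus 1 (w j)) c0; rewrite /=.
transitivity (Cmult 1 (Cmult (Cpow (RtoC (INR N ^ j)) c0) x)); first by rewrite Cmult_1_l.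
by rewrite -{1}e'; ring.
Qed.

(** * Vertical translates and continuation to [C_0] *)

(** Composition multiplies [a n] by the unimodular [n^{-i tau}] and moves it to index [n^c0]. For
    [c0 >= 1] this index map is injective, so no moduli merge. *)
Lemma isometry_of_vertical_translate (k c0 : nat) (tau : R) (phi : C -> C)
    (a b : nat -> C) :
  (1 <= c0)%N ->
  (forall s : C, 0 < Re s -> phi s = Cplus (Cmult (RtoC (INR c0)) s) (0, tau)) ->
  in_Akplus k a -> in_Akplus k b -> comp_rel phi a b -> normA b = normA a.
Proof.
move=> hc hphi ha hb hab.
pose a' n := Cmult (a n) (npow n (0, tau)).
have ea : forall n, Cmod (a' n) = Cmod (a n).
  by move=> n; rewrite Cmod_mult Cmod_npow /= Ropp_0 Rmult_0_l exp_0 Rmult_1_r.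
have hi : forall m n, (m < n)%N -> (m ^ c0 < n ^ c0)%N by move=> m n; rewrite ltn_exp2r.
pose b' := push (expn^~ c0) a'.
have [sa sb] : summable a /\ summable b by case: ha; case: hb.
have sa' : summable a' by apply: ex_series_ext sa => n; rewrite ea.
have hd : dirichlet_at (fun n => Cplus (b n) (Cmult (-1) (b' n))) 1 (fun=> 0).
  apply: dirichlet_at_summable.
  - rewrite (Akplus_0 _ _ hb) Cmult_m1 -[in b' _](exp0n hc) /b' push_at // /a' (Akplus_0 _ _ ha).
    by rewrite Cmult_0_l Copp_0 Cplus_0_l.
  - by apply: summable_plus => //; apply/summable_scal/summable_push.
  move=> j hj; have hs : 0 < Re (RtoC (INR j)) by exact: INR_gt0.
  have hre : 0 <= Re (phi (RtoC (INR j))).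
    rewrite hphi //= Rmult_0_l Rminus_0_r Rplus_0_r; apply: Rmult_le_pos; exact: pos_INR.
  have [v hv] := ex_dseries _ _ hre sa.
  have -> : RtoC 0 = Cplus v (Cmult (-1) v) by rewrite Cmult_m1 Cplus_opp_r.
  apply: dseries_plus; first exact: hab.
  apply/dseries_scal/dseries_push => //.
  apply: is_series_ext hv => n; rewrite /dterm hphi // npowD /a'.
  case: (posnP n) => [->|hn]; first by rewrite (Akplus_0 _ _ ha) !Cmult_0_l.
  by rewrite npow_expn // -Cmult_assoc (Cmult_comm (npow n (0, tau))).
have hbb : forall n, b n = b' n.
  (* Scaling by 0 gives a second series for the zero function, so uniqueness makes [b - b']
     vanish. *)
  move=> n; have e := dirichlet_at_unique _ _ _ _ hd
    (dirichlet_at_ext _ _ _ _ (fun j _ => Cmult_0_l 0) (dirichlet_at_scal 0 _ _ _ hd)) n.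
  have -> : b n = Cplus (Cplus (b n) (Cmult (-1) (b' n))) (b' n) by rewrite Cmult_m1; ring.
  by rewrite e Cmult_0_l Cplus_0_l.
have hn := push_Cmod _ _ _ hi (Series_correct _ sa').
rewrite /normA (Series_ext _ _ (fun n => f_equal Cmod (hbb n))) (is_series_unique _ _ hn).
exact: Series_ext.
Qed.

Lemma holomorphic_continuous (f : C -> C) (s : C) (eps : R) :
  holomorphic_C0 f -> 0 < Re s -> 0 < eps ->
  exists del, 0 < del /\ forall z, Cmod (Cminus z s) < del -> Cmod (Cminus (f z) (f s)) < eps.
Proof.
move=> hf hs he; have hc := ex_derive_continuous _ _ (hf s hs).
have [del hdel] := hc _ (locally_ball (T := AbsRing_NormedModule C_AbsRing) (f s) (mkposreal eps he)).
by exists del; split; [exact: cond_pos | move=> z hz; exact: (hdel z hz)].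
Qed.

(* The values of [f] lie in a discrete set, and every point is joined to the
   half-plane [sigma < Re s] by a horizontal segment. *)
Lemma constant_of_npow_constant (f : C -> C) (a : C) (sigma : R) :
  holomorphic_C0 f ->
  (forall s, 0 < Re s -> npow 2 (f s) = npow 2 a) ->
  (forall s, 0 < Re s -> sigma < Re s -> f s = a) ->
  forall s, 0 < Re s -> f s = a.
Proof.
move=> hf hn hs s s0.
have hL : 0 < ln 2 by rewrite -ln_1; apply: ln_increasing; lra.
have e2 : INR 2 = 2 by [].
apply: C_eq.
  have := f_equal Cmod (hn s s0); rewrite !Cmod_npow e2 => /exp_inv h.
  apply: (Rmult_eq_reg_r (ln 2)); lra.
(* [Rabs] keeps the path in the half-plane for every real [x], so that [g] is continuous on the
   whole line. *)
pose z x := Cplus s (RtoC (Rabs x)).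
have hz : forall x, 0 < Re (z x) by move=> x /=; have := Rabs_pos x; move: s0; rewrite /Re; lra.
pose g x := ln 2 * (Im (f (z x)) - Im a).
have hsin : forall x, sin (g x) = 0.
  move=> x; have := hn _ (hz x).
  have -> : f (z x) = Cplus (Cminus (f (z x)) a) a by ring.
  rewrite npowD => h; have {}h : npow 2 (Cminus (f (z x)) a) = 1.
    have := f_equal (fun w => Cmult w (Cinv (npow 2 a))) h.
    by rewrite -Cmult_assoc Cinv_r ?Cmult_1_r //; apply: npow_neq0.
  have := f_equal Im h; rewrite /npow e2 /= => /Rmult_integral [h1|].
    by have := exp_pos (- Re (Cminus (f (z x)) a) * ln 2); rewrite /Re /= in h1 *; lra.
  move=> h1; rewrite -(Ropp_involutive (g x)) sin_neg -[RHS]Ropp_0 -h1; congr (- sin _).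
  by rewrite /g /Im; ring.
have hg : continuity g.
  apply: continuity_mult; first by apply: continuity_const => ? ?.
  move=> x eps he; have [del [hd hdel]] := holomorphic_continuous _ _ _ hf (hz x) he.
  exists del; split=> // y [_]; rewrite /dist /= /Rdist => hy.
  have -> : Im (f (z y)) - Im a - (Im (f (z x)) - Im a) = Im (Cminus (f (z y)) (f (z x))).
    by rewrite /Im /=; ring.
  apply: Rle_lt_trans (Rabs_Im_le _) _; apply: hdel.
  have -> : Cminus (z y) (z x) = RtoC (Rabs y - Rabs x) by rewrite /z RtoC_minus; ring.
  by rewrite Cmod_R; apply: Rle_lt_trans (Rabs_triang_inv2 _ _) hy.
have gX : g (Rabs sigma) = 0.
  rewrite /g hs //; first by ring.
  rewrite /= Rabs_Rabsolu; have := Rle_abs sigma; move: s0; rewrite /Re; lra.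
have g0 : g 0 = ln 2 * (Im (f s) - Im a).
  by rewrite /g /z Rabs_R0 Cplus_0_r.
suff h : g 0 = 0.
  rewrite g0 in h; case: (Rmult_integral _ _ h) => h1; lra.
case: (Req_EM_T (g 0) 0) => // hne.
(* [v] is [g 0] clipped to [[-1, 1]]: a nonzero value lying between [g 0] and 0, with nonzero sine
   because [1 < PI]. *)
have [v [hv [v0 hv1]]] : exists v, (Rmin (g 0) 0 <= v <= Rmax (g 0) 0) /\ v <> 0 /\ -1 <= v <= 1.
  case: (Rdichotomy _ _ hne) => h0.
  - exists (Rmax (g 0) (-1)); rewrite (Rmin_left (g 0) 0) ?(Rmax_right (g 0) 0); try lra.
    rewrite /Rmax; case: (Rle_dec (g 0) (-1)) => h1 /=; split; try lra; (split; [move=> e|]); lra.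
  - exists (Rmin (g 0) 1); rewrite (Rmin_right (g 0) 0) ?(Rmax_left (g 0) 0); try lra.
    rewrite /Rmin; case: (Rle_dec (g 0) 1) => h1 /=; split; try lra; (split; [move=> e|]); lra.
have hv' : Rmin (g 0) (g (Rabs sigma)) <= v <= Rmax (g 0) (g (Rabs sigma)) by rewrite gX.
have [x [_ hx]] := IVT_gen g 0 (Rabs sigma) v hg hv'.
have hsv : sin v = 0 by rewrite -hx.
have hpi := PI2_1; have hpi2 : PI / 2 < PI by have := PI_RGT_0; lra.
case: (Rtotal_order v 0) => [h1|[h1|h1]] //.
- have := sin_lt_0_var v; lra.
- have := sin_gt_0 v; lra.
Qed.

(** * Isometric composition operators *)

Lemma INR_Re_gt0 (j0 j : nat) : (0 < j0)%N -> (j0 <= j)%N -> 0 < Re (RtoC (INR j)).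
Proof. by move=> h1 h2; apply: INR_gt0; lia. Qed.

Lemma dirichlet_at_comp (k : nat) (phi : C -> C) (m j0 : nat) (b : nat -> C) :
  (0 < j0)%N -> in_Akplus k b -> comp_rel phi (delta m) b ->
  dirichlet_at b j0 (fun j => npow m (phi (RtoC (INR j)))).
Proof.
move=> hj0 hb cb; apply: dirichlet_at_summable; [exact: Akplus_0 hb | by case: hb |].
by move=> j hj; apply: comp_rel_delta => //; apply: INR_Re_gt0 hj.
Qed.

Section Isometry.
Variables (k c0 : nat) (psi phi : C -> C).
Hypothesis hphi : forall s : C, phi s = Cplus (Cmult (RtoC (INR c0)) s) (psi s).
Hypothesis hbdd : forall a : nat -> C, in_Akplus k a ->
  exists b : nat -> C, in_Akplus k b /\ comp_rel phi a b.
Hypothesis iso : forall a b : nat -> C, in_Akplus k a -> in_Akplus k b ->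
  comp_rel phi a b -> normA b = normA a.
Variables (c : nat -> C) (j0 : nat).
Hypothesis hj0 : (0 < j0)%N.
Hypothesis hc : dirichlet_at c j0 (fun j => psi (RtoC (INR j))).

Lemma comp_leading_coef (m : nat) (b : nat -> C) :
  (0 < m)%N -> in_Akplus k b -> comp_rel phi (delta m) b -> b (m ^ c0)%N <> 0.
Proof.
move=> hm hb cb; apply: (leading_coef_npow _ _ _ _ _ _ hc hm).
by apply: dirichlet_at_ext (dirichlet_at_comp _ _ _ _ _ hj0 hb cb) => j _; rewrite hphi.
Qed.

(** The index [m'^c0] is occupied by the image of [m'^{-s}], so disjointness empties it in every
    other image. *)
Lemma other_leading_coef_zero (m m' : nat) (b : nat -> C) :
  smooth k m -> smooth k m' -> m <> m' -> in_Akplus k b -> comp_rel phi (delta m) b ->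
  b (m' ^ c0)%N = 0.
Proof.
move=> hm hm' ne hb cb.
have [b' [hb' cb']] := hbdd _ (in_Akplus_delta _ _ hm').
have hp : (0 < m')%N by case/andP: hm'.
by case: (isometry_disjoint _ _ _ _ _ _ iso hm hm' ne hb cb hb' cb' (m' ^ c0)%N) => //
  /(comp_leading_coef _ _ hp hb' cb').
Qed.

(** For [c0 = 0] the images of the monomials 1 and 2 would share the leading index 1. *)
Lemma isometry_c0_gt0 : (1 <= k)%N -> (1 <= c0)%N.
Proof.
move=> hk; case: (posnP c0) => // e.
have [b [hb cb]] := hbdd _ (in_Akplus_delta _ _ (smooth2 _ hk)).
case: (comp_leading_coef 2 b _ hb cb) => //.
have := other_leading_coef_zero 2 1 b (smooth2 _ hk) (smooth1 _) _ hb cb.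
by rewrite e !expn0; apply.
Qed.

Lemma next_coef_zero (N : nat) : (1 <= k)%N -> supported_k k c ->
  (2 <= N)%N -> (forall n, (2 <= n < N)%N -> c n = 0) -> c N = 0.
Proof.
(* Smoothness of [N] is what allows [(2^i N)^{-s}] to serve as a test function. *)
move=> hk hsupp hN hlow; case E: (smooth k N); last exact: hsupp.
have hN0 : (0 < N)%N by lia.
have hQ : (0 < 2 ^ c0)%N by rewrite expn_gt0.
pose u j := Cminus (psi (RtoC (INR j))) (c 1%N).
have hu0 : Climit u 0.
  have hlow1 : forall n, (n < 1)%N -> c n = 0 by case=> // _; case: hc.
  have h := leading_coef_limit _ _ _ 1 hc (ltnSn 0) hlow1.
  rewrite -(Cplus_opp_r (c 1%N)); apply: Climit_plus (Climit_const _).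
  by apply: (Climit_ext_loc _ _ _ 0) h => j _; rewrite pow1 Cmult_1_l.
have huN : Climit (fun j => Cmult (RtoC (INR N ^ j)) (u j)) (c N).
  (* Adding [- c 1] times [delta 1] removes the constant term, so [N] becomes the first index that
     can be occupied. *)
  have hd := dirichlet_at_plus _ _ _ _ _ hc
    (dirichlet_at_scal (Copp (c 1%N)) _ _ _ (dirichlet_at_delta 1 j0 (ltnSn 0))).
  have := leading_coef_limit _ _ _ N hd hN0.
  rewrite /delta (_ : (N == 1%N) = false) ?Cmult_0_r ?Cplus_0_r; last by lia.
  move=> h; apply: (Climit_ext_loc _ _ _ 0) (h _).
    by move=> j _; rewrite /u Rinv_1 pow1 Cmult_1_r.
  move=> n hn; case: n hn => [|[|n]] hn; rewrite /= ?Cmult_0_r ?Cplus_0_r.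
  - by case: hc.
  - by rewrite Cmult_1_r Cplus_opp_r.
  - by apply: hlow; lia.
have hw : forall i, exists b, dirichlet_at b j0
    (fun j => Cmult (Cpow (RtoC ((/ INR (2 ^ c0)) ^ j)) i) (Cpow (npow 2 (u j)) i)) /\
    b ((2 ^ c0) ^ i * N ^ c0)%N = 0.
  move=> i; have hi : smooth k (2 ^ i) by apply/smooth_expn/smooth2.
  have [b [hb cb]] := hbdd _ (in_Akplus_delta _ _ hi).
  have K0 : Cpow (npow 2 (c 1%N)) i <> 0 by apply/Cpow_nz/npow_neq0.
  (* The image of [(2^i)^{-s}] carries the constant [2^{-i c_1}], which is divided out to leave
     powers of [2^{-u}]. *)
  exists (fun n => Cmult (Cinv (Cpow (npow 2 (c 1%N)) i)) (b n)); split.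
    apply: dirichlet_at_ext (dirichlet_at_scal _ _ _ _ (dirichlet_at_comp _ _ _ _ _ hj0 hb cb)).
    move=> j _; rewrite npow_expn // npow_INR_mul hphi.
    have -> : psi (RtoC (INR j)) = Cplus (u j) (c 1%N) by rewrite /u; ring.
    rewrite !npowD -npow_expn // npow_INR // !Cpow_mult_l.
    by field.
  (* The index becomes [(2^i N)^c0], the leading one for the monomial [2^i N], which differs from
     [2^i] since [N >= 2]. *)
  rewrite -expnM (mulnC c0) expnM -expnMn.
  rewrite (other_leading_coef_zero (2 ^ i) (2 ^ i * N) b) ?Cmult_0_r //.
  - exact: smooth_mul.
  - have : (0 < 2 ^ i)%N by rewrite expn_gt0.
    nia.
have hL : 0 < ln 2 by rewrite -ln_1; apply: ln_increasing; lra.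
have hz0 : Climit (fun j => Cmult (RtoC (- ln 2)) (u j)) 0.
  by rewrite -(Cmult_0_r (RtoC (- ln 2))); apply: Climit_mult hu0; apply: Climit_const.
have hzN : Climit (fun j => Cmult (RtoC (INR N ^ j)) (Cmult (RtoC (- ln 2)) (u j)))
    (Cmult (RtoC (- ln 2)) (c N)).
  apply: (Climit_ext_loc _ _ _ 0) (Climit_mult _ _ _ _ (Climit_const (RtoC (- ln 2))) huN).
  by move=> j _; ring.
have hd : Climit (fun j => Cmult (RtoC (INR N ^ j)) (Cminus 1 (npow 2 (u j))))
    (Cmult (-1) (Cmult (RtoC (- ln 2)) (c N))).
  apply: (Climit_ext_loc _ _ _ 0)
    (Climit_mult _ _ _ _ (Climit_const (-1)) (cexp_scaled_limit _ _ _ hz0 hzN)) => j _.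
  rewrite Cmult_m1 npowE (_ : Copp (Cmult (u j) (RtoC (ln (INR 2)))) = Cmult (RtoC (- ln 2)) (u j)); first by ring.
  by rewrite RtoC_opp (_ : INR 2 = 2) //; ring.
have := leading_difference_zero _ _ _ _ _ _ hQ hN0 hw hd.
rewrite Cmult_m1 => h; case: (Ceq_dec (c N) 0) => // cN.
have hln : RtoC (- ln 2) <> 0 by move=> /RtoC_inj; lra.
case: (Cmult_neq_0 _ _ hln cN).
rewrite (_ : Cmult _ _ = Copp (Copp (Cmult (RtoC (- ln 2)) (c N)))); last by ring.
by rewrite h Copp_0.
Qed.

End Isometry.

Theorem theorem23 (k : nat) (hk : (1 <= k)%N) (c0 : nat) (psi phi : C -> C)
  (hpsi : in_Dk k psi)
  (hphi : forall s : C, phi s = Cplus (Cmult (RtoC (INR c0)) s) (psi s))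
  (hmap : forall s : C, 0 < Re s -> 0 < Re (phi s))
  (hnonconst : ~ (exists c : C, forall s : C, 0 < Re s -> phi s = c))
  (hbdd : forall a : nat -> C, in_Akplus k a ->
            exists b : nat -> C, in_Akplus k b /\ comp_rel phi a b) :
  (forall a b : nat -> C, in_Akplus k a -> in_Akplus k b -> comp_rel phi a b ->
     normA b = normA a)
  <->
  ((1 <= c0)%N /\ exists tau : R, forall s : C, 0 < Re s ->
     phi s = Cplus (Cmult (RtoC (INR c0)) s) (0, tau)).
Proof.
split=> [iso|[hc [tau htau]] a b]; last exact: isometry_of_vertical_translate hc htau.
have [c [j0 [sigma [hsupp [hj0 [hc hser]]]]]] := in_Dk_dirichlet _ _ hpsi.
have hc0 := isometry_c0_gt0 _ _ _ _ hphi hbdd iso _ _ hj0 hc hk.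
split=> //.
have hcz : forall n, (2 <= n)%N -> c n = 0.
  elim/ltn_ind => n IH hn.
  apply: (next_coef_zero _ _ _ _ hphi hbdd iso _ _ hj0 hc) => // m /andP [h1 h2].
  exact: IH.
have hpsi1 : forall s, sigma < Re s -> psi s = c 1%N.
  move=> s hs; have h := dseries_scal (c 1%N) _ _ _ (dseries_delta 1 s).
  rewrite npow1 Cmult_1_r in h; apply: (dseries_unique _ _ _ _ (hser s hs)).
  apply: is_series_ext h => n; rewrite /dterm /delta; case: n => [|[|n]] /=.
  - by rewrite Cmult_0_r; case: hc => ->.
  - by rewrite Cmult_1_r.
  - by rewrite Cmult_0_r hcz.
have [b [hb cb]] := hbdd _ (in_Akplus_delta _ _ (smooth2 _ hk)).
set K := npow 2 (c 1%N).
have hQ : (0 < 2 ^ c0)%N by rewrite expn_gt0.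
(* Beyond [sigma] the image of [2^{-s}] is a multiple of one monomial; uniqueness turns this into an
   identity of coefficients. *)
have hbK : forall n, b n = Cmult K (delta (2 ^ c0) n).
  have [j1 hj1] := INR_unbounded sigma.
  apply: (dirichlet_at_unique _ _ (j0 + j1)) (dirichlet_at_scal K _ _ _ (dirichlet_at_delta _ _ hQ)).
  have hj : (0 < j0 + j1)%N by lia.
  apply: dirichlet_at_ext (dirichlet_at_comp _ _ _ _ _ hj hb cb) => j hjj.
  rewrite hphi hpsi1; last by apply: Rlt_le_trans hj1 _; apply: le_INR; lia.
  by rewrite npowD -npow_expn // npow_INR // Cmult_comm.
have hK : Cmod K = 1.
  have := iso _ _ (in_Akplus_delta _ _ (smooth2 _ hk)) hb cb.
  rewrite normA_delta => <-; symmetry; apply: is_series_unique.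
  have := is_series_scal (Cmod K) _ _ (is_series_delta (2 ^ c0)).
  rewrite /scal /= /mult /= Rmult_1_r; apply: is_series_ext => n.
  by rewrite hbK Cmod_mult.
have hre : Re (c 1%N) = 0.
  have hL : 0 < ln 2 by rewrite -ln_1; apply: ln_increasing; lra.
  move: hK; rewrite Cmod_npow -exp_0 (_ : INR 2 = 2) // => /exp_inv h.
  by apply: (Rmult_eq_reg_r (ln 2)); lra.
have hpsiE : forall s, 0 < Re s -> psi s = c 1%N.
  apply: (constant_of_npow_constant _ _ sigma); first by case: hpsi.
  (* With [b] explicit, its series gives the image of [2^{-s}] on all of the half-plane, so dividing
     by the monomial extends the identity to the left of [sigma]. *)
  - move=> s hs; have := comp_rel_delta _ _ _ _ cb hs.
    have hd := dseries_scal K _ _ _ (dseries_delta (2 ^ c0) s).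
    have hd' : dseries_to b s (Cmult K (npow (2 ^ c0) s)).
      by apply: is_series_ext hd => n; rewrite /dterm hbK.
    move=> /dseries_unique /(_ hd').
    rewrite hphi npowD npow_expn // Cmult_comm => h.
    have := f_equal (fun w => Cmult w (Cinv (npow 2 (Cmult (RtoC (INR c0)) s)))) h.
    by rewrite -!Cmult_assoc Cinv_r ?Cmult_1_r //; apply: npow_neq0.
  - by move=> s _; apply: hpsi1.
exists (Im (c 1%N)) => s hs; rewrite hphi hpsiE //.
by congr Cplus; apply: C_eq.
Qed.
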